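(* Let $n, k \geq 1$ and let $r \geq 2$ be even. Then every $r$-uniform convex geometric hypergraph on $\Omega_n$ that contains no $k$-zigzag has at most $\frac{(k-1)(r-1)}{r}\binom{n}{r-1}$ edges; that is, $\mathrm{ex}_{\circlearrowright}(n,\mathsf{P}_k^r) \leq \frac{(k-1)(r-1)}{r}\binom{n}{r-1}$.
   Context: $\Omega_n$ is a set of $n$ points in strictly convex position in the plane, equipped with its cyclic (clockwise) ordering $\prec$. An $r$-uniform convex geometric hypergraph (cgh) on $\Omega_n$ is a set $H$ of $r$-element subsets of $\Omega_n$ (its edges). A segment of $\Omega_n$ is a set of consecutive points in the cyclic order; for disjoint segments we write $I_0 \prec I_1 \prec \dots \prec I_{r-1}$ if they appear in this order going once around clockwise, and each segment is linearly ordered by $\prec$ (clockwise from its first point). For $k \geq 1$ and even $r \geq 2$, a $k$-zigzag in $H$ is a sequence of distinct points $v_0, v_1, \dots, v_{k+r-2}$ of $\Omega_n$ such that $\{v_i,\dots,v_{i+r-1}\} \in H$ for all $0 \leq i < k$ (a tight $k$-path), and there exist disjoint segments $I_0 \prec I_1 \prec \dots \prec I_{r-1}$ of $\Omega_n$ with $\{v_i : i \equiv j \pmod r\} \subseteq I_j$ for $0 \le j < r$, such that (i) if $j$ is even then $v_j \prec v_{j+r} \prec v_{j+2r} \prec \cdots$ within $I_j$, and (ii) if $j$ is odd then $v_j \succ v_{j+r} \succ v_{j+2r} \succ \cdots$ within $I_j$. $\mathrm{ex}_{\circlearrowright}(n,\mathsf P_k^r)$ is the maximum number of edges of an $r$-uniform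 cgh on $\Omega_n$ containing no $k$-zigzag. *)

(* Defs.v *)
From mathcomp Require Import all_boot all_order all_algebra.
From mathcomp Require Import boolp.

Set Implicit Arguments.
Unset Strict Implicit.
Unset Printing Implicit Defensive.

(* Omega_n is 'I_n, the points being numbered 0, ..., n-1 clockwise: the
   cyclic order is the only part of the plane geometry that is used. *)

(* Number of clockwise steps from a to x. *)
Definition cwdist (n : nat) (a x : 'I_n) : nat := (x + (n - a)) %% n.

(* x comes strictly before y when going once around clockwise from a. *)
Definition cwlt (n : nat) (a x y : 'I_n) : Prop := cwdist a x < cwdist a y.

(* S is a (nonempty) set of consecutive points with first point a; the linear
   order of such a segment is cwlt a. *)
Definition segment_from (n : nat) (a : 'I_n) (S : {set 'I_n}) : Prop :=
  exists2 l : nat, 0 < l <= n & S = [set x | cwdist a x < l].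

(* I_0 < I_1 < ... < I_(r-1), where a j is the first point of I j: the turn
   around Omega_n starts at the first point of I_0. *)
Definition segments_in_order (n r : nat)
    (a : 'I_r -> 'I_n) (I : 'I_r -> {set 'I_n}) : Prop :=
  [/\ forall j, segment_from (a j) (I j),
      forall i j, i != j -> [disjoint I i & I j]
    & forall o i j : 'I_r, o = 0 :> nat -> i < j ->
        forall x y, x \in I i -> y \in I j -> cwlt (a o) x y].

Definition uniform_cgh (n r : nat) (H : {set {set 'I_n}}) : Prop :=
  forall e, e \in H -> #|e| = r.

(* Only the terms v 0, ..., v (k + r - 2) of v are relevant. *)
Definition tight_path (n r k : nat) (H : {set {set 'I_n}})
    (v : nat -> 'I_n) : Prop :=
  (forall i j, i < k + r - 1 -> j < k + r - 1 -> v i = v j -> i = j) /\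
  (forall i, i < k -> [set v (i + t) | t : 'I_r] \in H).

Definition zigzag (n r k : nat) (H : {set {set 'I_n}})
    (v : nat -> 'I_n) : Prop :=
  tight_path r k H v /\
  exists (a : 'I_r -> 'I_n) (I : 'I_r -> {set 'I_n}),
    [/\ segments_in_order a I,
        forall (j : 'I_r) i, i < k + r - 1 -> i %% r = j -> v i \in I j,
        forall (j : 'I_r) i, i + r < k + r - 1 -> i %% r = j -> ~~ odd j ->
          cwlt (a j) (v i) (v (i + r))
      & forall (j : 'I_r) i, i + r < k + r - 1 -> i %% r = j -> odd j ->
          cwlt (a j) (v (i + r)) (v i)].

Definition zigzag_free (n r k : nat) (H : {set {set 'I_n}}) : Prop :=
  ~ exists v, zigzag r k H v.

Definition ex_zigzag (n r k : nat) : nat :=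
  \max_(H : {set {set 'I_n}} | `[< uniform_cgh r H /\ zigzag_free r k H >])
    #|H|.

(* Main.v *)
Require Import Defs.
From mathcomp Require Import all_boot all_order all_algebra.
From mathcomp Require Import boolp zify.

(* Following Perles, mark in each edge e a point x to be replaced next; there are
   r |H| marked edges.  Such a pair is the cyclically ordered r-tuple of e
   starting at x, and it occupies a gap of the cyclically ordered (r-1)-tuple
   e - x; there are (r-1) C(n, r-1) such (r-1)-tuples.  A zigzag is extended by
   moving x inside its gap, clockwise and counterclockwise alternately, and then
   passing the mark to the next point of the edge.  Hence at each extension at
   most one marked edge per gap is lost, and if
   r |H| > (k-1) (r-1) C(n, r-1), some marked edge survives k-1 extensions. *)

Set Implicit Arguments.
Unset Strict Implicit.
Unset Printing Implicit Defensive.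

Import GRing.Theory Num.Theory.

(** * Clockwise distances and cyclically sorted sequences *)

Section CyclicSequences.
Variable n : nat.
Implicit Types (a b x y : 'I_n) (s f : seq 'I_n).

Lemma cwdistE a x : cwdist a x = if a <= x then x - a else x + n - a.
Proof.
rewrite /cwdist; have an := ltn_ord a; have xn := ltn_ord x.
case: leqP => ax; last by rewrite modn_small; lia.
have -> : x + (n - a) = x - a + n by lia.
by rewrite modnDr modn_small; lia.
Qed.

(** Change of origin: it turns betweenness seen from different points into linear arithmetic on
    distances from one point. *)
Lemma cwdist_rebase b a x : cwdist a x =
  if cwdist b a <= cwdist b x then cwdist b x - cwdist b a
  else cwdist b x + n - cwdist b a.
Proof.
rewrite !cwdistE; have := ltn_ord a; have := ltn_ord b; have := ltn_ord x.
case: (leqP b a) => ?; case: (leqP b x) => ?; case: (leqP a x) => ? *;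
  by case: leqP => ?; lia.
Qed.

Lemma ltn_cwdist a x : cwdist a x < n.
Proof. by rewrite /cwdist ltn_mod; case: n a => // -[]. Qed.

Lemma cwdistxx a : cwdist a a = 0.
Proof. by rewrite cwdistE leqnn subnn. Qed.

Lemma cwdist_inj a : injective (cwdist a).
Proof.
move=> x y exy; apply: val_inj => /=; move: exy; rewrite !cwdistE.
have := ltn_ord a; have := ltn_ord x; have := ltn_ord y.
by case: (leqP a x) => ?; case: (leqP a y) => ?; lia.
Qed.

(** The three betweenness lemmas carry the order along an arc starting at [p] over to distances from
    [b]. Here [p] comes before [x], so the arc from [p] to [x] does not wrap past [b]. *)
Lemma cwdist_between b p x y : cwdist b p < cwdist b x ->
  0 < cwdist p y < cwdist p x -> cwdist b p < cwdist b y < cwdist b x.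
Proof.
rewrite !(cwdist_rebase b p); have := ltn_cwdist b x; have := ltn_cwdist b y.
case: (leqP (cwdist b p) (cwdist b y)) => ?;
  by case: (leqP (cwdist b p) (cwdist b x)) => ?; lia.
Qed.

Lemma cwdist_between_after b p x y z : cwdist b p < cwdist b x < cwdist b z ->
  cwdist p x < cwdist p y < cwdist p z -> cwdist b x < cwdist b y < cwdist b z.
Proof.
rewrite !(cwdist_rebase b p).
have := ltn_cwdist b x; have := ltn_cwdist b y; have := ltn_cwdist b z.
case: (leqP (cwdist b p) (cwdist b y)) => ?;
  case: (leqP (cwdist b p) (cwdist b z)) => ?;
  by case: (leqP (cwdist b p) (cwdist b x)) => ?; lia.
Qed.

(** Here the arc from [p] to [z] goes through [b]. The case [z = p] stands for the full circle; then
    [cwdist p z] is 0, hence the guard on the last hypothesis. *)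
Lemma cwdist_between_before b p x y z : cwdist b x < cwdist b z <= cwdist b p ->
  cwdist p x < cwdist p y -> (z != p -> cwdist p y < cwdist p z) ->
  cwdist b x < cwdist b y < cwdist b z.
Proof.
have [->|_] := eqVneq z p; last move=> h1 h2 /(_ isT); last move: h1 h2.
  rewrite !(cwdist_rebase b p).
  have := ltn_cwdist b x; have := ltn_cwdist b y; have := ltn_cwdist b p.
  case: (leqP (cwdist b p) (cwdist b y)) => ?;
    by case: (leqP (cwdist b p) (cwdist b x)) => ?; lia.
rewrite !(cwdist_rebase b p).
have := ltn_cwdist b x; have := ltn_cwdist b y; have := ltn_cwdist b p.
have := ltn_cwdist b z.
case: (leqP (cwdist b p) (cwdist b y)) => ?;
  case: (leqP (cwdist b p) (cwdist b z)) => ?;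
  by case: (leqP (cwdist b p) (cwdist b x)) => ?; lia.
Qed.

Definition cyc_sorted s :=
  has (fun i => sorted ltn (map val (rot i s))) (iota 0 (size s).+1).

Lemma cyc_sortedP s :
  reflect (exists s1 s2, s = s2 ++ s1 /\ sorted ltn (map val (s1 ++ s2)))
          (cyc_sorted s).
Proof.
apply: (iffP hasP) => [[i _ si]|[s1 [s2 [-> ss]]]].
  by exists (drop i s), (take i s); rewrite cat_take_drop.
exists (size s2); last by rewrite rot_size_cat.
by rewrite mem_iota /= add0n ltnS size_cat leq_addr.
Qed.

Lemma cyc_sorted_rcons f x : cyc_sorted (rcons f x) = cyc_sorted (x :: f).
Proof.
apply/cyc_sortedP/cyc_sortedP => -[s1 [s2 []]].
  case/lastP: s1 => [|s1 z].
    rewrite cats0 => <- ss; exists f, [:: x].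
    by rewrite cats1.
  rewrite -rcons_cat => /rcons_inj [-> ->]; rewrite cat_rcons => ss.
  by exists s1, (z :: s2).
case: s2 => [|z s2] /=.
  by move=> <-; rewrite cats0 => ss; exists [:: x], f; rewrite cats1.
move=> [-> ->] ss; exists (rcons s1 z), s2.
by rewrite rcons_cat cat_rcons.
Qed.

Lemma cyc_sorted_behead x f : cyc_sorted (x :: f) -> cyc_sorted f.
Proof.
case/cyc_sortedP => s1 [[|z s2] []] /=.
  move=> <-; rewrite cats0 /= => /path_sorted ss; apply/cyc_sortedP.
  by exists f, [::]; rewrite cats0.
move=> [_ ->] ss; apply/cyc_sortedP; exists s1, s2; split=> //.
apply: subseq_sorted ss; first exact: ltn_trans.
by apply: map_subseq; apply: cat_subseq => //; apply: subseq_cons.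
Qed.

(** Increasing labels make [cwdist x] increase on any block lying on one side of [x]. The sequence
    is a block from [x] on, possibly followed by a block of smaller labels, whose distances are
    larger because they wrap past label 0. *)
Lemma cyc_sorted_cwdist x f :
  cyc_sorted (x :: f) -> sorted ltn (map (cwdist x) (x :: f)).
Proof.
case/cyc_sortedP => s1 [s2 [Es]].
rewrite !sorted_pairwise; [|exact: ltn_trans|exact: ltn_trans].
rewrite Es !map_cat !pairwise_cat => /and3P[/allrelP r12 p1 p2].
have mono s : pairwise ltn (map val s) -> (forall y, y \in s -> x <= y) \/
    (forall y, y \in s -> y < x) -> pairwise ltn (map (cwdist x) s).
  rewrite !pairwise_map => ps sx; apply: (sub_in_pairwise _ (allss s) ps).
  move=> y z ys zs /=.
  rewrite !cwdistE; have := ltn_ord z; have := ltn_ord x.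
  case: sx => sx; have := sx _ ys; have := sx _ zs;
    by case: (leqP x y) => ?; case: (leqP x z) => ?; lia.
have hp : forall s, x :: f = s -> pairwise ltn (map val s) ->
    forall y, y \in s -> x <= y.
  move=> _ <- /= /andP[/allP xs _] y; rewrite inE => /orP[/eqP-> //|ys].
  by apply: ltnW; apply: xs; apply: map_f.
case: s2 Es r12 p2 => [|z s2] Es r12 p2.
  by rewrite /= mono //; left; apply: hp p1.
case: (Es) => xz _; rewrite -{}xz in Es r12 p2 *.
have x2 y : y \in x :: s2 -> x <= y.
  rewrite inE => /orP[/eqP-> //|ys]; apply: ltnW.
  by move: p2 => /= /andP[/allP/(_ y)] H _; apply: H; apply: map_f.
have x1 y : y \in s1 -> y < x.
  by move=> ys; apply: r12; apply: map_f => //; rewrite mem_head.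
rewrite !mono //; [|by right|by left]; rewrite !andbT.
apply/allrelP => _ _ /mapP[y ys ->] /mapP[z' zs ->].
have := x2 _ ys; have := x1 _ zs; rewrite !cwdistE.
by have := ltn_ord y; case: (leqP x y) => ?; case: (leqP x z') => ?; lia.
Qed.

End CyclicSequences.

(** * From cyclically sorted windows with alternating moves to a zigzag *)

Section NestedWindows.
Variables (n q k : nat) (v : nat -> 'I_n).
Let r := q.+1.
Let w i := cwdist (v 0) (v i).
Hypotheses (q_odd : odd q) (k_gt0 : 0 < k).
Hypothesis window_cyc : forall i, i < k ->
  cyc_sorted (mkseq (fun t => v (i + t)) r).
(** The point [v (i + q)] opens the gap in which [v i] is replaced by [v (i + r)]: the move is
    clockwise for even [i], counterclockwise for odd [i]. *)
Hypothesis step_mono : forall i, i.+1 < k ->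
  if odd i then cwdist (v (i + q)) (v (i + r)) < cwdist (v (i + q)) (v i)
  else cwdist (v (i + q)) (v i) < cwdist (v (i + q)) (v (i + r)).

Let r_even : odd r = false. Proof. by rewrite /r /= q_odd. Qed.

Lemma congr_mod_le i m : i %% r = m %% r -> i < m + r -> i <= m.
Proof.
move=> /eqP e lt; rewrite leqNgt; apply/negP => mi.
move: e; rewrite eqn_mod_dvd; last exact: ltnW.
by move=> /dvdn_leq; rewrite subn_gt0 mi => /(_ isT); lia.
Qed.

Lemma first_window_sorted i j : i < j < r -> w i < w j.
Proof.
move=> /andP[ij jr]; have := window_cyc k_gt0; rewrite /mkseq /=.
move=> /cyc_sorted_cwdist; rewrite -[v (0 + 0) :: _]/(mkseq _ r).
rewrite /mkseq -map_comp => /(sorted_ltn_nth ltn_trans 0) /(_ i j).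
rewrite !inE !size_map size_iota !(nth_map 0) ?size_iota; try lia.
by rewrite !nth_iota /= ?add0n; try lia; apply=> //; lia.
Qed.

(** Rotated to start at [v (m + q)], window [m.+1] continues with [v (m + r)] and then, if [1 < q],
    with [v m.+1]; for [q = 1] the latter is [v (m + q)] itself. *)
Lemma next_gap m : m.+1 < k ->
  let d := cwdist (v (m + q)) in
  0 < d (v (m + r)) /\ (1 < q -> d (v (m + r)) < d (v m.+1)).
Proof.
move=> mk /=; have q0 : 0 < q by case: q q_odd.
have := window_cyc mk.
have -> : mkseq (fun t => v (m.+1 + t)) r =
    rcons (rcons (mkseq (fun t => v (m.+1 + t)) q.-1) (v (m + q))) (v (m + r)).
  rewrite /r mkseqS; have -> : mkseq (fun t => v (m.+1 + t)) q =
      rcons (mkseq (fun t => v (m.+1 + t)) q.-1) (v (m.+1 + q.-1)).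
    by rewrite -mkseqS prednK.
  by congr (rcons (rcons _ (v _)) (v _)); lia.
rewrite !(cyc_sorted_rcons, =^~ rcons_cons) => /cyc_sorted_cwdist /=.
rewrite cwdistxx => /andP[-> p]; split=> // q1; move: p.
by case: q q1 => [|[|q']] //= _ /andP[]; rewrite addn0.
Qed.

(* Consecutive classes 2c, 2c + 1 modulo r move towards each other, so nothing
   ever leaves the intervals spanned by the first window and going around the
   circle never wraps past v 0. *)
Lemma window_invariant m : m < k ->
  (forall i j, i < m + r -> j < m + r -> i %% r < j %% r -> w i < w j) /\
  (forall i j, i < j -> j < m + r -> i %% r = j %% r ->
     if odd i then w j < w i else w i < w j).
Proof.
elim: m => [_|m IHm mk].
  split=> i j; rewrite add0n.
    by move=> ir jr; rewrite !modn_small // => ij; apply: first_window_sorted; lia.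
  by move=> ij jr; rewrite !modn_small //; lia.
have {IHm} [cross mono] := IHm (ltnW mk).
have rE : r = q.+1 by [].
have q0 : 0 < q by case: q q_odd.
have cr : m %% r < q.+1 by rewrite ltn_mod.
have om : odd (m %% r) = odd m by rewrite odd_mod.
have modP : (m + q) %% r = if m %% r == 0 then q else (m %% r).-1.
  rewrite -modnDml; case: eqP => [->|/eqP c0]; first by rewrite modn_small.
  have -> : m %% r + q = (m %% r).-1 + r by lia.
  by rewrite modnDr modn_small; lia.
(* The last class [q] is odd, so an even [m] is not in it and [m.+1] does not wrap to class 0. *)
have modS : ~~ odd m -> m.+1 %% r = (m %% r).+1.
  move=> em; rewrite -addn1 -modnDml addn1 modn_small //.
  have : m %% r != q by apply: contraNneq em => e; rewrite -om e.
  by lia.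
have modr : (m + r) %% r = m %% r by rewrite modnDr.
have [dpos dlt] := next_gap mk.
(* Seen from [v 0], the new point falls between [v m] and the latest point of the class it moves
   towards, which is that of [m + q] or of [m.+1]. *)
have gap : if odd m then w (m + q) < w (m + r) < w m
           else w m < w (m + r) < w m.+1.
  case: ifP (step_mono mk) => om' dm.
    have c0 : 0 < m %% r by move: om; rewrite om'; case: (m %% r).
    apply: cwdist_between; last by rewrite dpos.
    by apply: cross; rewrite ?modP ?gtn_eqF //; clear -rE c0; lia.
  have em : ~~ odd m by rewrite om'.
  have lt : w m < w m.+1.
    by apply: cross; rewrite ?modS //; clear -rE q0; lia.
  (* For class 0, the point [v (m + q)] is in the last class and the gap goes through [v 0];
     otherwise it is in the class just before that of [m]. *)
  have [c0|c0] := posnP (m %% r).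
    apply: (@cwdist_between_before _ _ (v (m + q))) => //.
      rewrite -!/(w _) lt /=; have [->|q1] := eqVneq q 1; first by rewrite addn1.
      apply: ltnW; apply: cross; rewrite ?modP ?modS ?c0 ?eqxx //; clear -rE q0 q1; lia.
    move=> ne; apply: dlt; rewrite ltn_neqAle q0 andbT eq_sym.
    by apply: contra_neq ne => ->; rewrite addn1.
  have q1 : 1 < q.
    by move: c0 cr om; rewrite om'; case: (m %% r) => [|[]] // c _; clear; lia.
  apply: (@cwdist_between_after _ _ (v (m + q))); last by rewrite dm dlt.
  rewrite -!/(w _) lt andbT.
  by apply: cross; rewrite ?modP ?gtn_eqF //; clear -rE c0; lia.
have oldlt i : i < m.+1 + r -> i != m + r -> i < m + r by clear; lia.
have mr : m < m + r by clear -rE; lia.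
have m1r : m.+1 < m + r by clear -rE q0; lia.
have mqr : m + q < m + r by clear -rE; lia.
split=> i j.
  move=> im jm.
  have [->|ni] := eqVneq i (m + r); have [->|nj] := eqVneq j (m + r).
  - by rewrite ltnn.
  - rewrite modr => cj; have {}jm := oldlt _ jm nj.
    case: (boolP (odd m)) gap => om' /andP[gl gr].
      by apply: ltn_trans gr _; apply: cross.
    have := modS om'; move: cj; rewrite leq_eqVlt => /predU1P[jc e|jc e].
      (* The class of [m.+1] is odd, hence decreasing, so its latest index [m.+1] gives its
         minimum. *)
      have : j <= m.+1.
        by apply: congr_mod_le; [rewrite e jc | rewrite addSn ltnS ltnW].
      rewrite leq_eqVlt => /predU1P[-> //|jm'].
      have oj : odd j by rewrite -(odd_mod j r_even) -jc /= om om'.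
      apply: ltn_trans gr _; have := mono _ _ jm' m1r.
      by rewrite oj; apply; rewrite e jc.
    by apply: ltn_trans gr _; apply: cross; rewrite ?e.
  - rewrite modr => ic; have {}im := oldlt _ im ni.
    case: (boolP (odd m)) gap => om' /andP[gl gr]; last first.
      by apply: ltn_trans gl; apply: cross.
    have c0 : 0 < m %% r by apply: leq_ltn_trans ic.
    have e : (m + q) %% r = (m %% r).-1 by rewrite modP gtn_eqF.
    apply: leq_ltn_trans gl; have [ei|ni'] := eqVneq (i %% r) ((m + q) %% r).
      (* Symmetrically, the class of [m + q] is even, hence increasing, and its latest index gives
         its maximum. *)
      have : i <= m + q by apply: congr_mod_le => //; clear -im; lia.
      rewrite leq_eqVlt => /predU1P[-> //|im'].
      have oi : ~~ odd i.
        rewrite -(odd_mod i r_even) ei e; move: om c0; rewrite om'.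
        by case: (m %% r) => //= ? ->.
      by apply: ltnW; have := mono _ _ im' mqr ei; rewrite (negbTE oi).
    apply: ltnW; apply: cross => //; rewrite ltn_neqAle ni' e -ltnS.
    by rewrite prednK.
  - by apply: cross; apply: oldlt.
move=> ij jm; have [ej|nj] := eqVneq j (m + r); last first.
  by apply: mono ij _; apply: oldlt.
rewrite ej modr => e.
have im : i <= m by apply: congr_mod_le => //; rewrite -ej.
have oi : odd i = odd m by rewrite -(odd_mod i r_even) e om.
move: im; rewrite leq_eqVlt oi => /predU1P[->|im].
  by case: ifP gap => _ /andP[].
have := mono _ _ im mr e; rewrite oi; case: ifP gap => _ /andP[gl gr] wim.
  exact: ltn_trans gr wim.
exact: ltn_trans wim gl.
Qed.

Let N := k + r - 1.

Let class_lt i j : i < N -> j < N -> i %% r < j %% r -> w i < w j.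
Proof.
have NE : N = k.-1 + r by rewrite /N /r; lia.
by rewrite NE; apply: (window_invariant _).1; rewrite prednK.
Qed.

Let class_mono i j : i < j -> j < N -> i %% r = j %% r ->
  if odd i then w j < w i else w i < w j.
Proof.
have NE : N = k.-1 + r by rewrite /N /r; lia.
by rewrite NE; apply: (window_invariant _).2; rewrite prednK.
Qed.

(** At [m = k.-1] the invariant covers all [k + r - 1] points. The classes then occupy successive
    ranges of distance from [v 0], and cutting the circle at the first point of each class yields
    the segments. *)
Lemma zigzag_of_windows (H : {set {set 'I_n}}) :
  (forall i, i < k -> [set v (i + t) | t : 'I_r] \in H) -> zigzag r k H v.
Proof.
move=> vH; have rN : r <= N by rewrite /N; lia.
have winj i j : i < N -> j < N -> w i = w j -> i = j.
  move=> iN jN wij; have [e|e|e] := ltngtP (i %% r) (j %% r).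
  - by have := class_lt iN jN e; rewrite wij ltnn.
  - by have := class_lt jN iN e; rewrite wij ltnn.
  have [ij|ij|//] := ltngtP i j.
    by have := class_mono ij jN e; rewrite wij; case: ifP; rewrite ltnn.
  by have := class_mono ij iN (esym e); rewrite wij; case: ifP; rewrite ltnn.
split; first by split=> // i j iN jN vij; apply: winj => //; rewrite /w vij.
(* The first point of class [j]; the class is nonempty since it contains the index [j] itself. *)
have [m mP] : exists m : 'I_r -> nat, forall j, [/\ m j < N, m j %% r = j
    & forall i, i < N -> i %% r = j -> w (m j) <= w i].
  pose i0 (j : 'I_r) : 'I_N := widen_ord rN j.
  exists (fun j => [arg min_(i < i0 j | i %% r == j) w i] : nat) => j.
  case: arg_minnP => [|i /eqP ij imin]; first by rewrite /= modn_small.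
  by split=> // i' i'N i'j; apply: (imin (Ordinal i'N)); rewrite /= i'j.
(* I_j is the set of points at distance L j, ..., L j.+1 - 1 from v 0. *)
pose L j := if insub j is Some jj then w (m jj) else n.
have Lord (j : 'I_r) : L j = w (m j) by rewrite /L valK.
(* The value [n] at [r] lets the last segment run until the turn is complete. *)
have LN j : r <= j -> L j = n by move=> rj; rewrite /L insubN // -leqNgt.
have LS i j : i %% r = j -> i < N -> w i < L j.+1.
  move=> ij iN; have [jr|jr] := ltnP j.+1 r; last by rewrite LN // ltn_cwdist.
  rewrite -[j.+1]/(Ordinal jr : nat) Lord; have [mN mj _] := mP (Ordinal jr).
  by apply: class_lt; rewrite // mj ij /=.
have Llt (j : 'I_r) : L j < L j.+1.
  by rewrite Lord; have [mN mj _] := mP j; apply: LS.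
have Lmono i j : i <= j -> j <= r -> L i <= L j.
  move=> ij; elim: j ij => [|j IHj]; first by rewrite leqn0 => /eqP->.
  rewrite leq_eqVlt => /predU1P[-> //|ij] jr.
  apply: leq_trans (IHj _ (ltnW jr)) (ltnW (Llt (Ordinal jr))).
  by rewrite -ltnS.
have Ln j : j <= r -> L j <= n by move=> jr; rewrite -(LN r) // Lmono.
pose a (j : 'I_r) := v (m j).
pose I (j : 'I_r) := [set x | cwdist (a j) x < L j.+1 - L j].
have cwa (j : 'I_r) x : L j <= cwdist (v 0) x ->
    cwdist (a j) x = cwdist (v 0) x - L j.
  by move=> Lx; rewrite (cwdist_rebase (v 0)) -/(w (m j)) -Lord Lx.
have inI (j : 'I_r) x : (x \in I j) = (L j <= cwdist (v 0) x < L j.+1).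
  rewrite inE (cwdist_rebase (v 0)) -/(w (m j)) -Lord.
  have := Llt j; have := Ln _ (ltn_ord j); have := ltn_cwdist (v 0) x.
  by case: (leqP (L j) (cwdist (v 0) x)) => ? ? ? ?; apply/idP/idP; lia.
have Lle (j : 'I_r) i : i < N -> i %% r = j -> L j <= w i.
  by move=> iN ij; rewrite Lord; have [_ _] := mP j; apply.
exists a, I; split.
- split.
  + move=> j; exists (L j.+1 - L j) => //.
    by have := Llt j; have := Ln _ (ltn_ord j); lia.
  + have dis (i j : 'I_r) : i < j -> [disjoint I i & I j].
      move=> ij; apply/pred0P => x /=; rewrite !inI.
      by have := Lmono _ _ ij (ltnW (ltn_ord j)); lia.
    move=> i j; rewrite neq_ltn => /orP[]; first exact: dis.
    by rewrite disjoint_sym; apply: dis.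
  + move=> o i j o0 ij x y; rewrite !inI => xi yj.
    have Lo : L o = 0.
      apply/eqP; rewrite -leqn0 -(cwdistxx (v 0)); apply: Lle; last by rewrite mod0n.
      exact: leq_trans rN.
    rewrite /cwlt !cwa ?Lo //; have := Lmono _ _ ij (ltnW (ltn_ord j)); lia.
- by move=> j i iN ij; rewrite inI Lle //= LS.
- move=> j i iN ij ej; have iN' : i < N by apply: leq_ltn_trans iN; apply: leq_addr.
  have eij : (i + r) %% r = i %% r by rewrite modnDr.
  have : w i < w (i + r).
    have := @class_mono i (i + r) _ iN (esym eij).
    rewrite -(odd_mod i r_even) ij (negbTE ej); apply.
    by rewrite -[X in X < _]addn0 ltn_add2l.
  have := Lle j _ iN' ij; have := Lle j (i + r) iN; rewrite eij => /(_ ij) l1 l2.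
  by rewrite /cwlt !cwa // => lt; apply: ltn_sub2r (leq_ltn_trans l2 lt) lt.
- move=> j i iN ij ej; have iN' : i < N by apply: leq_ltn_trans iN; apply: leq_addr.
  have eij : (i + r) %% r = i %% r by rewrite modnDr.
  have : w (i + r) < w i.
    have := @class_mono i (i + r) _ iN (esym eij).
    rewrite -(odd_mod i r_even) ij ej; apply.
    by rewrite -[X in X < _]addn0 ltn_add2l.
  have := Lle j _ iN' ij; have := Lle j (i + r) iN; rewrite eij => /(_ ij) l1 l2.
  by rewrite /cwlt !cwa // => lt; apply: ltn_sub2r (leq_ltn_trans l1 lt) lt.
Qed.

End NestedWindows.

(** * Counting cyclically sorted tuples *)

Section CyclicTuples.
Variables (n q : nat).

Lemma cyc_sorted_rot (s : seq 'I_n) i :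
  sorted ltn (map val s) -> cyc_sorted (rot i s).
Proof.
move=> ss; apply/cyc_sortedP; exists (take i s), (drop i s).
by rewrite cat_take_drop.
Qed.

Lemma card_cyc_sorted : 0 < q ->
  #|[set f : q.-tuple 'I_n | cyc_sorted f]| <= q * 'C(n, q).
Proof.
move=> q0; pose T := [set t : q.-tuple 'I_n | sorted ltn (map val t)].
pose g (ti : q.-tuple 'I_n * 'I_q) : q.-tuple 'I_n := [tuple of rot ti.2 ti.1].
apply: (@leq_trans #|g @: setX T setT|).
  apply/subset_leq_card/subsetP => f; rewrite inE => /cyc_sortedP[s1 [s2 [fE ss]]].
  have szs : size s1 + size s2 = q by rewrite addnC -size_cat -fE size_tuple.
  have sz : size (s1 ++ s2) == q by rewrite size_cat szs.
  (* If [s2] is empty the rotation is by [q], which is the rotation by 0. *)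
  have iq : size s1 %% q < q by rewrite ltn_mod.
  apply/imsetP; exists (Tuple sz, Ordinal iq); first by rewrite !inE ss.
  apply: val_inj; rewrite /= fE.
  have [s1q|s1q] := ltnP (size s1) q; first by rewrite modn_small // rot_size_cat.
  have s20 : s2 = [::] by apply: size0nil; lia.
  have -> : size s1 = q by lia.
  by rewrite modnn rot0 s20 cats0.
apply: leq_trans (leq_imset_card _ _) _.
by rewrite cardsX cardsT card_ord /T card_ltn_sorted_tuples mulnC.
Qed.

Lemma sorted_enum_ord (e : {set 'I_n}) : sorted ltn (map val (enum e)).
Proof.
apply: (@subseq_sorted _ ltn ltn_trans _ (map val (enum 'I_n))).
  by apply: map_subseq; rewrite enumT; apply: filter_subseq.
by rewrite val_enum_ord iota_ltn_sorted.
Qed.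

(** The rotations of the increasing enumeration of an edge correspond to the choices of its marked
    point. *)
Lemma card_cyc_sorted_edges (H : {set {set 'I_n}}) : uniform_cgh q.+1 H ->
  #|H| * q.+1 <=
    #|[set t : q.+1.-tuple 'I_n | cyc_sorted t && ([set x in t] \in H)]|.
Proof.
move=> Hr.
pose T := [set t : q.+1.-tuple 'I_n | sorted ltn (map val t) &
                                      [set x in t] \in H].
have HT : #|H| <= #|T|.
  apply: leq_trans (leq_imset_card (fun t : q.+1.-tuple _ => [set x in t]) _).
  apply/subset_leq_card/subsetP => e eH.
  have sz : size (enum e) == q.+1 by rewrite -cardE Hr.
  have eE : [set x in Tuple sz] = e by apply/setP => x; rewrite inE mem_enum.
  apply/imsetP; exists (Tuple sz); last by rewrite eE.
  by rewrite inE eE eH sorted_enum_ord.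
pose g (ti : q.+1.-tuple 'I_n * 'I_q.+1) : q.+1.-tuple 'I_n :=
  [tuple of rot ti.2 ti.1].
have g_inj : {in setX T setT &, injective g}.
  move=> [t i] [t' i']; rewrite !inE /= !andbT.
  move=> /andP[ts _] /andP[ts' _] /(congr1 val) /= eg.
  (* A rotation determines its set of points, hence the sorted tuple; its first entry then
     determines the offset, as entries are distinct. *)
  have tt' : t = t'.
    apply: val_inj; apply: (inj_map val_inj).
    apply: (irr_sorted_eq ltn_trans ltnn) => // x.
    apply: perm_mem; apply: perm_map; rewrite -(perm_rot i) eg.
    by rewrite perm_rot.
  subst t'; congr (_, _); apply: val_inj => /=.
  have ut : uniq t.
    by rewrite -(map_inj_uniq val_inj) (sorted_uniq ltn_trans ltnn).
  have hd j : j < q.+1 -> nth (thead t) (rot j t) 0 = nth (thead t) t j.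
    by move=> jq; rewrite nth_cat size_drop size_tuple subn_gt0 jq nth_drop addn0.
  apply/eqP; rewrite -(nth_uniq (thead t) _ _ ut) ?size_tuple //.
  by rewrite -!hd // eg.
apply: leq_trans (_ : #|T| * q.+1 <= _); first by rewrite leq_mul2r HT orbT.
rewrite -[X in _ * X](card_ord q.+1) -cardsT -cardsX -(card_in_imset g_inj).
apply/subset_leq_card/subsetP => _ /imsetP[[t i] ti ->].
move: ti; rewrite !inE /= andbT => /andP[ts tH]; rewrite cyc_sorted_rot //=.
suff -> : [set x in rot i t] = [set x in t] by [].
by apply/setP => x; rewrite !inE mem_rot.
Qed.

End CyclicTuples.

(** * Extending zigzags and counting the losses *)

Section ZigzagEnds.
Variables (n q : nat) (H : {set {set 'I_n}}).
Hypothesis q_gt0 : 0 < q.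
Implicit Type t : q.+1.-tuple 'I_n.

(* Offset of the first point of t in the gap of the other q points: two tuples
   with the same behead are compared along their common gap. *)
Definition gap_position t := cwdist (last (thead t) t) (thead t).

(** The move goes from [t'] to [t]: the head of [t'] is replaced by that of [t], counterclockwise if
    [b] holds and clockwise otherwise. *)
Definition extendible (A : {set q.+1.-tuple 'I_n}) b t :=
  [exists t' in A, (behead t' == behead t) &&
     (if b then gap_position t < gap_position t'
      else gap_position t' < gap_position t)].

(* The last windows (v_m, ..., v_(m+q)) of some (m+1)-zigzags: a tuple of
   zigzag_ends m with a predecessor in its gap, in the direction given by the
   parity of m, prolongs the zigzag ending at that predecessor. *)
Fixpoint zigzag_ends m : {set q.+1.-tuple 'I_n} :=
  if m is m'.+1 then
    [set [tuple of rot 1 t] | t : q.+1.-tuple 'I_n in zigzag_ends m' &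
                              extendible (zigzag_ends m') (odd m') t]
  else [set t : q.+1.-tuple 'I_n | cyc_sorted t && ([set x in t] \in H)].

Lemma zigzag_ends_cyc m t :
  t \in zigzag_ends m -> cyc_sorted t && ([set x in t] \in H).
Proof.
elim: m t => [t|m IHm _ /imsetP[t tA ->]]; first by rewrite inE.
have -> : [set x in [tuple of rot 1 t]] = [set x in t].
  by apply/setP => x; rewrite !inE mem_rot.
move: tA; rewrite inE => /andP[/IHm /andP[+ ->] _]; rewrite andbT.
by case/tupleP: t => x f; rewrite /= rot1_cons cyc_sorted_rcons.
Qed.

(** As [q > 0], the last point lies in the common tail, so both gap positions are measured from the
    same point. *)
Lemma last_behead_eq t t' : behead t = behead t' ->
  last (thead t) t = last (thead t') t'.
Proof.
case/tupleP: t => x f; case/tupleP: t' => y f' /= ->.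
by case: f' => -[] //=; case: q q_gt0.
Qed.

(* Every gap loses at most one tuple, its extremal one. *)
Lemma card_zigzag_ends_step m :
  #|zigzag_ends m| <= #|zigzag_ends m.+1| + q * 'C(n, q).
Proof.
set A := zigzag_ends m; pose X := [set t | extendible A (odd m) t].
rewrite -(cardsID X A); apply: leq_add.
  rewrite -(card_imset (A :&: X) (f := fun t => [tuple of rot 1 t])); last first.
    by move=> t t' /(congr1 val) /rot_inj /val_inj.
  apply/subset_leq_card/subsetP => _ /imsetP[t /setIP[tA tX] ->].
  by apply/imsetP; exists t => //; rewrite inE tA; rewrite inE in tX.
apply: leq_trans (card_cyc_sorted n q_gt0).
(* Lost tuples are counted by their gaps, which are cyclically sorted [q]-tuples. *)
pose b t : q.-tuple 'I_n := [tuple of behead t].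
have b_inj : {in A :\: X &, injective b}.
  move=> t t'; rewrite !inE => /andP[/existsPn nt tA] /andP[/existsPn nt' tA'].
  move=> /(congr1 val) /= bb; have lb := last_behead_eq bb.
  have := nt t'; have := nt' t; rewrite tA tA' bb eqxx /=.
  (* Were the positions different, one of the two tuples would be a predecessor of the other, which
     would not be lost. *)
  have [lt|lt|ge] := ltngtP (gap_position t) (gap_position t');
    [by case: odd|by case: odd|].
  move=> _ _; move: ge; rewrite /gap_position lb => /cwdist_inj hd.
  rewrite (tuple_eta t) (tuple_eta t'); apply: val_inj => /=.
  by rewrite hd bb.
rewrite -(card_in_imset b_inj); apply/subset_leq_card/subsetP => _ /imsetP[t tA ->].
move: tA; rewrite !inE => /andP[_ /zigzag_ends_cyc /andP[+ _]].
by case/tupleP: t => x f; apply: cyc_sorted_behead.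
Qed.

Lemma card_zigzag_ends m :
  #|zigzag_ends 0| <= #|zigzag_ends m| + m * (q * 'C(n, q)).
Proof.
elim: m => [|m IHm]; first by rewrite mul0n addn0.
apply: leq_trans IHm _; rewrite mulSn addnA leq_add2r.
exact: card_zigzag_ends_step.
Qed.

(** The zigzag is recovered by following predecessors back: take the sequence ending at the
    predecessor [t'] and append the head of [t] as the point of index [m + q.+1]. *)
Lemma zigzag_ends_windows m t : t \in zigzag_ends m ->
  exists v : nat -> 'I_n,
  [/\ mkseq (fun i => v (m + i)) q.+1 = t,
      forall i, i <= m -> cyc_sorted (mkseq (fun j => v (i + j)) q.+1) &&
        ([set x in mkseq (fun j => v (i + j)) q.+1] \in H)
    & forall i, i < m ->
      if odd i then cwdist (v (i + q)) (v (i + q.+1)) < cwdist (v (i + q)) (v i)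
      else cwdist (v (i + q)) (v i) < cwdist (v (i + q)) (v (i + q.+1))].
Proof.
elim: m t => [|m IHm] t tA.
  exists (nth (thead t) t).
  have tE : mkseq (fun i => nth (thead t) t (0 + i)) q.+1 = t.
    by rewrite -[RHS](mkseq_nth (thead t)) size_tuple.
  split=> // i; rewrite leqn0 => /eqP->; rewrite tE.
  exact: zigzag_ends_cyc tA.
have := zigzag_ends_cyc tA; case/imsetP: tA => {}t + ->; rewrite inE => /andP[tA].
case/existsP=> t' /and3P[t'A /eqP bt gt].
have [v [vE vA vlt]] := IHm _ t'A => rt.
pose v' i := if i < m + q.+1 then v i else thead t.
have v'E i : i < m + q.+1 -> v' i = v i by rewrite /v' => ->.
have v'N : v' (m + q.+1) = thead t by rewrite /v' ltnn.
have bE : mkseq (fun i => v' (m.+1 + i)) q = behead t.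
  rewrite -bt -vE /= /mkseq (iotaDl 1 0 q) -map_comp.
  apply/eq_in_map => i; rewrite mem_iota /= => iq; rewrite v'E; first congr v; lia.
have wE : mkseq (fun i => v' (m.+1 + i)) q.+1 = [tuple of rot 1 t].
  rewrite mkseqS bE addSnnS v'N; case/tupleP: t {gt bt rt v' v'E v'N bE tA} => x f.
  by rewrite /= rot1_cons theadE.
exists v'; split=> // i.
  rewrite leq_eqVlt => /predU1P[->|im]; first by rewrite wE.
  suff -> : mkseq (fun j => v' (i + j)) q.+1 = mkseq (fun j => v (i + j)) q.+1 by apply: vA.
  by apply/eq_in_map => j; rewrite mem_iota => jq; apply: v'E; lia.
rewrite ltnS leq_eqVlt => /predU1P[->|im]; last first.
  by rewrite !v'E; [exact: vlt | lia..].
have hd : v m = thead t' by rewrite /thead (tnth_nth (v 0)) -vE /= addn0.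
have ls : v (m + q) = last (thead t') t' by rewrite -vE mkseqS last_rcons.
rewrite v'N !v'E; [|lia..]; rewrite hd ls.
by move: gt; rewrite /gap_position -(last_behead_eq bt).
Qed.

End ZigzagEnds.

(** * The bound on the number of edges *)

Lemma zigzag_free_card (n k r : nat) (H : {set {set 'I_n}}) :
  0 < k -> 1 < r -> ~~ odd r -> uniform_cgh r H -> zigzag_free r k H ->
  #|H| * r <= k.-1 * (r.-1 * 'C(n, r.-1)).
Proof.
case: r => // q k0 q0 /= /negPn q_odd Hr free.
apply: leq_trans (card_cyc_sorted_edges Hr) _.
apply: leq_trans (card_zigzag_ends H q0 k.-1) _.
rewrite -{2}[_ * _]add0n leq_add2r leqn0 cards_eq0.
(* A tuple surviving [k.-1] extensions would end a [k]-zigzag, so none survives and the losses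
   account for all marked edges. *)
apply: contra_notT free => /set0Pn[t tA].
have [v [_ vA vlt]] := zigzag_ends_windows q0 tA.
have ik1 i : i < k -> i <= k.-1 by lia.
have {}vA i (ik : i < k) := vA i (ik1 i ik).
exists v; apply: zigzag_of_windows => // [i /vA /andP[] //|i ik|i /vA /andP[_]].
  by apply: vlt; lia.
suff -> : [set x in mkseq (fun j => v (i + j)) q.+1] =
          [set v (i + j) | j : 'I_q.+1] by [].
apply/setP => x; rewrite in_set.
apply/idP/idP => [/mapP[j]|/imsetP[j _ ->]].
  rewrite mem_iota => jq ->.
  by apply/imsetP; exists (Ordinal (jq : j < q.+1)).
by apply: (map_f (fun t => v (i + t))); rewrite mem_iota ltn_ord.
Qed.

Local Open Scope ring_scope.

Theorem theorem1p5 (n k r : nat)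
    (hn : (1 <= n)%N) (hk : (1 <= k)%N) (hr : (2 <= r)%N) (hr_even : ~~ odd r) :
  (forall H : {set {set 'I_n}}, uniform_cgh r H -> zigzag_free r k H ->
     #|H|%:R <= (k%:R - 1) * (r%:R - 1) / r%:R * 'C(n, r - 1)%:R :> rat) /\
  (ex_zigzag n r k)%:R
    <= (k%:R - 1) * (r%:R - 1) / r%:R * 'C(n, r - 1)%:R :> rat.
Proof.
(* Clearing the denominator [r] leaves an inequality between natural numbers. *)
have bound c : (c * r <= k.-1 * (r.-1 * 'C(n, r.-1)))%N ->
    c%:R <= (k%:R - 1) * (r%:R - 1) / r%:R * 'C(n, r - 1)%:R :> rat.
  have r0 : (0 : rat) < r%:R by rewrite ltr0n; lia.
  have natr_pred m : (0 < m)%N -> m%:R - 1 = m.-1%:R :> rat.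
    by move=> m0; rewrite -subn1 natrB.
  rewrite subn1 !natr_pred //; last exact: ltnW.
  by rewrite mulrAC ler_pdivlMr // -!natrM ler_nat mulnA.
split=> [H Hr free|]; apply: bound; first exact: zigzag_free_card.
apply: (big_ind (fun c => c * r <= _)%N) => // [c d cr dr|H /asboolP[Hr free]].
  by rewrite /maxn; case: ifP.
exact: zigzag_free_card.
Qed.
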